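(* Let $\mathbf{F}\in[L^2(\mathbb{R}^2)]^2$ be supported in the bounded domain $\Omega$. Let $\mathcal{T}=\{\tau_1,\tau_2,\tau_3\}$ consist of three different complex numbers such that $\tau_2-\tau_1$ and $\tau_3-\tau_1$ are linearly independent (as vectors in $\mathbb{C}\cong\mathbb{R}^2$). Fix $\mathbf{z}\in\mathbb{R}^2\setminus\overline\Omega$ and $\mathbf{q}\in\mathbb{S}$. Then $\mathbf{F}$ is uniquely determined (among sources supported in $\Omega$) by the phaseless data sets $$\mathcal{D}_p=\{|u^\infty_{\mathbf{F}\cup\{\mathbf{z}\},p}(\hat{\mathbf{x}},\mathbf{q},\omega,\tau)|:\ \hat{\mathbf{x}}\in\mathbb{S}_{\mathbf{q}},\ \omega\in\mathbb{W},\ \tau\in\mathcal{T}\}$$ and $$\mathcal{D}_s=\{|u^\infty_{\mathbf{F}\cup\{\mathbf{z}\},s}(\hat{\mathbf{x}},\mathbf{q},\omega,\tau)|:\ \hat{\mathbf{x}}\in\mathbb{S}^\perp_{\mathbf{q}},\ \omega\in\mathbb{W},\ \tau\in\mathcal{T}\}.$$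
   Context: $\mathbb{W}=(\omega_{min},\omega_{max})$, $0<\omega_{min}<\omega_{max}$; Lamé constants $\mu>0$, $2\mu+\lambda>0$; $k_p=\omega/\sqrt{\lambda+2\mu}$, $k_s=\omega/\sqrt\mu$. $\mathbb{S}$ is the unit circle; $\hat{\mathbf{x}}^\perp$ is $\hat{\mathbf{x}}$ rotated anticlockwise by $\pi/2$. $\mathbb{S}_{\mathbf{q}}=\{\hat{\mathbf{x}}\in\mathbb{S}:\mathbf{q}\cdot\hat{\mathbf{x}}\ge 1/2\}$, $\mathbb{S}^\perp_{\mathbf{q}}=\{\hat{\mathbf{x}}\in\mathbb{S}:\mathbf{q}\cdot\hat{\mathbf{x}}^\perp\ge 1/2\}$. Source far fields: $u^\infty_{\mathbf{F},p}(\hat{\mathbf{x}},\omega)=\int_{\mathbb{R}^2}e^{-ik_p\hat{\mathbf{x}}\cdot\mathbf{y}}\hat{\mathbf{x}}\cdot\mathbf{F}(\mathbf{y})d\mathbf{y}$, $u^\infty_{\mathbf{F},s}(\hat{\mathbf{x}},\omega)=\int_{\mathbb{R}^2}e^{-ik_s\hat{\mathbf{x}}\cdot\mathbf{y}}\hat{\mathbf{x}}^\perp\cdot\mathbf{F}(\mathbf{y})d\mathbf{y}$; with an added point source, $u^\infty_{\mathbf{F}\cup\{\mathbf{z}\},p}(\hat{\mathbf{x}},\mathbf{q},\omega,\tau)=u^\infty_{\mathbf{F},p}(\hat{\mathbf{x}},\omega)+\tau e^{-ik_p\hat{\mathbf{x}}\cdot\mathbf{z}}\,\mathbf{q}\cdot\hat{\mathbf{x}}$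 and $u^\infty_{\mathbf{F}\cup\{\mathbf{z}\},s}(\hat{\mathbf{x}},\mathbf{q},\omega,\tau)=u^\infty_{\mathbf{F},s}(\hat{\mathbf{x}},\omega)+\tau e^{-ik_s\hat{\mathbf{x}}\cdot\mathbf{z}}\,\mathbf{q}\cdot\hat{\mathbf{x}}^\perp$. *)

(* Defs.v *)
From HB Require Import structures.
From mathcomp Require Import all_boot all_order all_algebra.
From mathcomp Require Import all_classical all_reals all_analysis.
From mathcomp Require Import complex.
Set Implicit Arguments. Unset Strict Implicit. Unset Printing Implicit Defensive.
Import Order.TTheory GRing.Theory Num.Theory ComplexField.
Import numFieldNormedType.Exports.
Local Open Scope classical_set_scope.
Local Open Scope ring_scope.
Local Open Scope complex_scope.

Section Defs.
Variable R : realType.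

Definition pt := (R * R)%type.

Definition leb2 := (@lebesgue_measure R \x @lebesgue_measure R)%E.

Definition dot (a b : pt) : R := a.1 * b.1 + a.2 * b.2.

Definition perp (x : pt) : pt := (- x.2, x.1).

Definition unit_circle : set pt := [set x | dot x x = 1].

Definition Sq (q : pt) : set pt :=
  [set x | unit_circle x /\ 1 / 2 <= dot q x].
Definition Sq_perp (q : pt) : set pt :=
  [set x | unit_circle x /\ 1 / 2 <= dot q (perp x)].

Definition kp (lam mu omega : R) : R := omega / Num.sqrt (lam + 2 * mu).
Definition ks (mu omega : R) : R := omega / Num.sqrt mu.

Definition rcdot (x : pt) (v : R[i] * R[i]) : R[i] :=
  (x.1)%:C * v.1 + (x.2)%:C * v.2.

Definition expi (t : R) : R[i] := (cos t) +i* (sin t).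

Definition cint2 (f : pt -> R[i]) : R[i] :=
  (\int[leb2]_y (complex.Re (f y))) +i* (\int[leb2]_y (complex.Im (f y))).

Definition uinf_p (lam mu : R) (F : pt -> R[i] * R[i]) (xh : pt) (omega : R) : R[i] :=
  cint2 (fun y => expi (- (kp lam mu omega * dot xh y)) * rcdot xh (F y)).
Definition uinf_s (mu : R) (F : pt -> R[i] * R[i]) (xh : pt) (omega : R) : R[i] :=
  cint2 (fun y => expi (- (ks mu omega * dot xh y)) * rcdot (perp xh) (F y)).

(* far fields with the added point source tau * q at z *)
Definition uinf_pz (lam mu : R) (F : pt -> R[i] * R[i]) (z q : pt)
    (xh : pt) (omega : R) (tau : R[i]) : R[i] :=
  uinf_p lam mu F xh omega
  + tau * expi (- (kp lam mu omega * dot xh z)) * (dot q xh)%:C.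
Definition uinf_sz (mu : R) (F : pt -> R[i] * R[i]) (z q : pt)
    (xh : pt) (omega : R) (tau : R[i]) : R[i] :=
  uinf_s mu F xh omega
  + tau * expi (- (ks mu omega * dot xh z)) * (dot q (perp xh))%:C.

Definition L2c (f : pt -> R[i]) : Prop :=
  measurable_fun setT (fun y => complex.Re (f y)) /\
  measurable_fun setT (fun y => complex.Im (f y)) /\
  (\int[leb2]_y ((complex.Re (f y)) ^+ 2 + (complex.Im (f y)) ^+ 2)%:E < +oo)%E.

Definition source_in (Omega : set pt) (F : pt -> R[i] * R[i]) : Prop :=
  L2c (fun y => (F y).1) /\ L2c (fun y => (F y).2) /\
  (forall y, ~ Omega y -> F y = (0, 0)).

Definition bounded_domain (Omega : set pt) : Prop :=
  Omega !=set0 /\ open Omega /\ connected Omega /\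
  (exists M : R, forall y, Omega y -> `|y.1| <= M /\ `|y.2| <= M).

Definition lin_indep_R (a b : R[i]) : Prop :=
  forall s t : R, s%:C * a + t%:C * b = 0 -> s = 0 /\ t = 0.

End Defs.

(* Main.v *)
Require Import Defs.
From HB Require Import structures.
From mathcomp Require Import all_boot all_order all_algebra.
From mathcomp Require Import all_classical all_reals all_analysis.
From mathcomp Require Import complex.
From mathcomp Require Import measurable_realfun ring lra.
Import Order.TTheory GRing.Theory Num.Theory ComplexField.
Import numFieldNormedType.Exports.
Local Open Scope classical_set_scope.
Local Open Scope ring_scope.

(* Since [q.x] (resp. [q.x^perp]) is bounded away from 0, the three moduli of
   [a + tau w] with non-collinear [tau] determine the far field [a] itself. For
   the difference [H] of two sources with the same data and a fixed direction
   [x], the function [t |-> \int exp(-i t x.y) x.H(y) dy] then vanishes on an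
   interval; being analytic, it has vanishing Taylor coefficients at 0, that is
   [\int (x.y)^n x.H(y) dy = 0]. This is a polynomial in [x] that vanishes on an
   open cone, hence for all [x]; likewise for [\int (x.y)^n x^perp.H(y) dy].
   Together they annihilate all moments [\int y1^j y2^k H(y) dy], and a compactly
   supported integrable function with zero moments vanishes almost everywhere. *)

(** * Integrable functions, bounded multipliers and vanishing moments *)

Section integral_lemmas.
Context {d : measure_display} {T : measurableType d} {R : realType}.
Variable mu : {measure set T -> \bar R}.
Implicit Types f g u : T -> R.

Definition Rintegrable f := mu.-integrable setT (EFin \o f).

(** The multipliers that preserve integrability. They form an algebra, so powers, cosines and sines
    of a bounded coordinate can all be put under the integral. *)
Definition bounded_mfun u :=
  measurable_fun setT u /\ exists M, forall y, `|u y| <= M.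

Lemma Rintegrable_measurable f : Rintegrable f -> measurable_fun setT f.
Proof. by move=> /measurable_int /measurable_EFinP. Qed.

Lemma RintegrableD f g : Rintegrable f -> Rintegrable g ->
  Rintegrable (fun y => f y + g y).
Proof.
by move=> fi gi; apply: eq_integrable (integrableD measurableT fi gi).
Qed.

Lemma RintegrableB f g : Rintegrable f -> Rintegrable g ->
  Rintegrable (fun y => f y - g y).
Proof.
by move=> fi gi; apply: eq_integrable (integrableB measurableT fi gi).
Qed.

Lemma RintegrableZ c f : Rintegrable f -> Rintegrable (fun y => c * f y).
Proof.
by move=> fi; apply: eq_integrable (integrableZl measurableT c fi).
Qed.

Lemma le_Rintegrable f g : measurable_fun setT f -> Rintegrable g ->
  (forall y, `|f y| <= g y) -> Rintegrable f.
Proof.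
move=> mf gi fg; apply: le_integrable gi => //; first exact/measurable_EFinP.
by move=> y _ /=; rewrite lee_fin (le_trans (fg y)) ?ler_norm.
Qed.

Lemma RintegrableM u f : bounded_mfun u -> Rintegrable f ->
  Rintegrable (fun y => u y * f y).
Proof.
move=> [mu_ [M uM]] fi.
apply: (@le_Rintegrable _ (fun y => M * `|f y|)).
- by apply: measurable_funM => //; exact: Rintegrable_measurable.
- by apply: RintegrableZ; exact: integrable_norm.
- by move=> y; rewrite normrM ler_wpM2r.
Qed.

Lemma Rintegrable_sum (N : nat) (f : nat -> T -> R) :
  (forall k, Rintegrable (f k)) -> Rintegrable (fun y => \sum_(k < N) f k y).
Proof.
move=> fi; elim: N => [|N IH].
  under eq_fun do rewrite big_ord0.
  exact: integrable0.
under eq_fun do rewrite big_ord_recr /=.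
exact: RintegrableD.
Qed.

Lemma Rintegral_sum (N : nat) (f : nat -> T -> R) :
  (forall k, Rintegrable (f k)) ->
  \int[mu]_y (\sum_(k < N) f k y) = \sum_(k < N) \int[mu]_y f k y.
Proof.
move=> fi; elim: N => [|N IH].
  rewrite big_ord0; under eq_Rintegral do rewrite big_ord0.
  by rewrite Rintegral_cst // mul0r.
rewrite big_ord_recr /= -IH.
have si := Rintegrable_sum N f fi.
rewrite -(RintegralD _ si (fi N)) //.
by apply: eq_Rintegral => y _; rewrite big_ord_recr.
Qed.

(** Dominated convergence in the one form used below, for polynomial approximations, monotone unions
    of sets and difference quotients. *)
Lemma Rdominated_eq0 (h : nat -> T -> R) f g :
  (forall n, measurable_fun setT (h n)) -> Rintegrable g ->
  (forall n y, `|h n y| <= g y) -> (forall y, h n y @[n --> \oo] --> f y) ->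
  (forall n, \int[mu]_y h n y = 0) -> \int[mu]_y f y = 0.
Proof.
move=> mh gi hg hf h0.
have mf : measurable_fun setT f.
  by apply: (measurable_fun_cvg mh) => y _; exact: hf.
have [] := @dominated_convergence _ _ _ mu setT measurableT
  (fun n => EFin \o h n) (EFin \o f) (EFin \o g).
- by move=> n; exact/measurable_EFinP.
- exact/measurable_EFinP.
- by apply: aeW => y _; apply: cvg_EFin; [exact: nearW|exact: hf].
- exact: gi.
- by apply: aeW => y n _; rewrite lee_fin.
move=> _ _; rewrite (_ : [sequence _]_n = cst 0%E) => [cvgf|].
  suff e : (\int[mu]_y (f y)%:E = 0)%E by rewrite /Rintegral e.
  by apply: (cvg_unique (@ereal_hausdorff R) cvgf); exact: cvg_cst.
(* A real integral is the [fine] part of the extended one; its vanishing carries over because [h n]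
   is integrable. *)
apply/funext => n /=; rewrite -[RHS]/(0%:E) -(h0 n) /Rintegral fineK //.
apply: integrable_fin_num => //.
exact: (le_Rintegrable _ _ (mh n) gi (hg n)).
Qed.

Lemma bounded_mfunM u v : bounded_mfun u -> bounded_mfun v ->
  bounded_mfun (fun y => u y * v y).
Proof.
move=> [mu_ [M uM]] [mv [N vN]]; split; first exact: measurable_funM.
by exists (M * N) => y; rewrite normrM ler_pM.
Qed.

Lemma bounded_mfunD u v : bounded_mfun u -> bounded_mfun v ->
  bounded_mfun (fun y => u y + v y).
Proof.
move=> [mu_ [M uM]] [mv [N vN]]; split; first exact: measurable_funD.
by exists (M + N) => y; rewrite (le_trans (ler_normD _ _)) // lerD.
Qed.

Lemma bounded_mfun_cst c : bounded_mfun (cst c).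
Proof. by split; [exact: measurable_cst|exists `|c|]. Qed.

Lemma bounded_mfunZ c u : bounded_mfun u -> bounded_mfun (fun y => c * u y).
Proof. by move=> bu; apply: bounded_mfunM => //; exact: bounded_mfun_cst. Qed.

Lemma bounded_mfunX u n : bounded_mfun u -> bounded_mfun (fun y => u y ^+ n).
Proof.
move=> bu; elim: n => [|n IH]; first exact: bounded_mfun_cst.
by under eq_fun do rewrite exprS; exact: bounded_mfunM.
Qed.

Lemma bounded_mfun_comp (h : R -> R) C u : continuous h ->
  (forall x, `|h x| <= C) -> measurable_fun setT u ->
  bounded_mfun (fun y => h (u y)).
Proof.
move=> ch hC mu_; split; last by exists C.
by apply: measurableT_comp => //; exact: continuous_measurable_fun.
Qed.

Lemma bounded_mfun_cos u : measurable_fun setT u ->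
  bounded_mfun (fun y => cos (u y)).
Proof.
by apply: (@bounded_mfun_comp _ 1); [exact: continuous_cos|exact: cos_max].
Qed.

Lemma bounded_mfun_sin u : measurable_fun setT u ->
  bounded_mfun (fun y => sin (u y)).
Proof.
by apply: (@bounded_mfun_comp _ 1); [exact: continuous_sin|exact: sin_max].
Qed.

Lemma bounded_mfun_indic (d' : measure_display) (T' : measurableType d')
    (g : T -> T') (A : set T') : measurable_fun setT g -> measurable A ->
  bounded_mfun (fun y => \1_A (g y) : R).
Proof.
move=> mg mA; split.
  by apply: (measurableT_comp (f := \1_A : T' -> R)) => //; exact: measurable_indic.
by exists 1 => y; rewrite indicE; case: (_ \in _); rewrite ?normr1 ?normr0.
Qed.

Lemma moments0_poly u f : bounded_mfun u -> Rintegrable f ->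
  (forall k, \int[mu]_y (u y ^+ k * f y) = 0) ->
  forall p : {poly R}, \int[mu]_y (p.[u y] * f y) = 0.
Proof.
move=> bu fi m0 p.
have ui k : Rintegrable (fun y => u y ^+ k * f y).
  exact/RintegrableM/fi/bounded_mfunX.
transitivity (\int[mu]_y (\sum_(k < size p) p`_k * (u y ^+ k * f y))).
  apply: eq_Rintegral => y _; rewrite horner_coef mulr_suml.
  by apply: eq_bigr => i _; rewrite mulrA.
rewrite (@Rintegral_sum _ (fun k y => p`_k * (u y ^+ k * f y))).
  by apply: big1 => k _; rewrite (RintegralZl _ _ (ui k)) // m0 mulr0.
by move=> k; exact/RintegrableZ/ui.
Qed.

(** The functions under the integral are dominated by [C * |f|]. Bound and convergence are required
    only on [[-M, M]], which contains the range of [u]; polynomials could not be bounded on the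
    whole line. *)
Lemma moments0_poly_lim u f (M C : R) (p : nat -> {poly R}) (h : R -> R) :
  measurable_fun setT u -> (forall y, `|u y| <= M) -> Rintegrable f ->
  (forall k, \int[mu]_y (u y ^+ k * f y) = 0) ->
  (forall n x, `|x| <= M -> `|(p n).[x]| <= C) ->
  (forall x, `|x| <= M -> (p n).[x] @[n --> \oo] --> h x) ->
  \int[mu]_y (h (u y) * f y) = 0.
Proof.
move=> mu_ uM fi m0 pC ph.
have bu : bounded_mfun u by split=> //; exists M.
apply: (@Rdominated_eq0 (fun n y => (p n).[u y] * f y) _ (fun y => C * `|f y|)).
- move=> n; apply: measurable_funM; last exact: Rintegrable_measurable.
  apply: (measurableT_comp (f := horner (p n))) => //.
  apply: continuous_measurable_fun; exact: continuous_horner.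
- by apply: RintegrableZ; exact: integrable_norm.
- by move=> n y; rewrite normrM ler_wpM2r // pC.
- by move=> y; apply: cvgMl; exact: ph.
- by move=> n; exact: moments0_poly.
Qed.

(* Taylor polynomials of [cos] and [sin], dominated by the exponential series. *)
Lemma moments0_cos_sin u f (t : R) : bounded_mfun u -> Rintegrable f ->
  (forall k, \int[mu]_y (u y ^+ k * f y) = 0) ->
  \int[mu]_y (cos (t * u y) * f y) = 0 /\
  \int[mu]_y (sin (t * u y) * f y) = 0.
Proof.
move=> [mu_ [M uM]] fi m0.
have key (c : nat -> R) (h : R -> R) : (forall k, `|c k| <= (k`!%:R)^-1) ->
    (forall x, series (fun n => c n * x ^+ n) @ \oo --> h x) ->
    \int[mu]_y (h (t * u y) * f y) = 0.
  move=> cb ch.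
  (* The factor [t] moves into the coefficients, so that [p n] is evaluated at [u y], whose moments
     are known. *)
  pose p n : {poly R} := \poly_(i < n) (c i * t ^+ i).
  have pE n x : (p n).[x] = series (fun n => c n * (t * x) ^+ n) n.
    rewrite /p horner_poly /series /= big_mkord; apply: eq_bigr => i _.
    by rewrite exprMn mulrA.
  apply: (@moments0_poly_lim u f M (expR (`|t| * M)) p (fun x => h (t * x))) => //.
  - move=> n x xM; rewrite pE /series /= (le_trans (ler_norm_sum _ _ _)) //.
    have xb : `|t * x| <= `|t| * M by rewrite normrM ler_wpM2l.
    apply: (@le_trans _ _ (series (exp_coeff (`|t| * M)) n)).
      apply: ler_sum => i _; rewrite normrM normrX /exp_coeff /= mulrC.
      by apply: ler_pM => //; rewrite lerXn2r ?nnegrE // (le_trans _ xb).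
    apply: nondecreasing_cvgn_le; last exact: is_cvg_series_exp_coeff.
    apply: nondecreasing_series => i _ _; rewrite /exp_coeff /= divr_ge0 //.
    by rewrite exprn_ge0 // (le_trans _ xb).
  - move=> x xM; under eq_fun do rewrite pE.
    exact: ch.
split.
- apply: (key (fun n => (~~(odd n))%:R * (-1) ^+ n./2 * (n`!%:R)^-1)).
    move=> k; rewrite !normrM normrX normrN1 expr1n mulr1 normfV !normr_nat.
    by case: odd; rewrite ?mul0r ?mul1r.
  by move=> x; rewrite -cos_coeffE unlock; exact: is_cvg_series_cos_coeff.
- apply: (key (fun n => (odd n)%:R * (-1) ^+ n.-1./2 * (n`!%:R)^-1)).
    move=> k; rewrite !normrM normrX normrN1 expr1n mulr1 normfV !normr_nat.
    by case: odd; rewrite ?mul0r ?mul1r.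
  by move=> x; rewrite -sin_coeffE unlock; exact: is_cvg_series_sin_coeff.
Qed.

End integral_lemmas.

(** * Polynomials that approximate a step function on the unit interval *)

Section step_polynomials.
Context {R : realType}.
Implicit Types x w r : R.

Lemma bernoulli_ge x m : 0 <= x <= 1 -> 1 - m%:R * x <= (1 - x) ^+ m.
Proof.
move=> /andP[x0 x1]; elim: m => [|m IH]; first by rewrite mul0r subr0 expr0.
rewrite exprS; apply: (@le_trans _ _ ((1 - x) * (1 - m%:R * x))).
  rewrite -natr1 -subr_ge0.
  have -> : (1 - x) * (1 - m%:R * x) - (1 - (m%:R + 1) * x) = m%:R * (x * x).
    by ring.
  by rewrite !mulr_ge0.
by rewrite ler_wpM2l // subr_ge0.
Qed.

(** Induction on [(1 - x) * (1 + (m + 1) * x) <= 1 + m * x]. The counterpart of Bernoulli's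
    inequality: it makes the power small once [m * x] is large. *)
Lemma bernoulli_le x m : 0 <= x <= 1 -> (1 - x) ^+ m * (1 + m%:R * x) <= 1.
Proof.
move=> /andP[x0 x1]; elim: m => [|m IH]; first by rewrite mul0r addr0 expr0 mul1r.
apply: le_trans IH; rewrite exprS mulrAC mulrC ler_wpM2l ?exprn_ge0 ?subr_ge0 //.
rewrite -natr1 -subr_ge0.
have -> : 1 + m%:R * x - (1 - x) * (1 + (m%:R + 1) * x) = (m%:R + 1) * (x * x).
  by ring.
by rewrite !mulr_ge0 ?addr_ge0.
Qed.

(** With [s] the square root of [r], one factor [s ^+ n] absorbs [n], since [bernoulli_le] at
    [1 - s] gives [n * s ^+ n <= 1 / (1 - s)]; the other factor tends to 0. *)
Lemma cvg_natmul_geometric r : 0 <= r < 1 ->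
  n%:R * r ^+ n @[n --> \oo] --> (0 : R).
Proof.
move=> /andP[r0 r1]; pose s := Num.sqrt r.
have s0 : 0 <= s by exact: sqrtr_ge0.
have sE : s ^+ 2 = r by exact: sqr_sqrtr.
have s1 : s < 1 by rewrite -sqrtr1 ltr_sqrt.
apply: (squeeze_cvgr (f := (cst 0)) (h := (geometric (1 - s)^-1 s))).
- apply: nearW => n; rewrite mulr_ge0 ?exprn_ge0 //= -sE -exprM mul2n -addnn.
  rewrite exprD mulrA ler_wpM2r ?exprn_ge0 //.
  rewrite -[X in _ <= X]mul1r ler_pdivlMr ?subr_gt0 //.
  have /(bernoulli_le _ n) : 0 <= 1 - s <= 1 by rewrite subr_ge0 ltW //= gerBl.
  move=> h; apply: le_trans h; rewrite subKr -subr_ge0.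
  have -> : s ^+ n * (1 + n%:R * (1 - s)) - n%:R * s ^+ n * (1 - s) = s ^+ n.
    by ring.
  exact: exprn_ge0.
- exact: cvg_cst.
- by apply: cvg_geometric; rewrite ger0_norm.
Qed.

(* These powers jump from 1 to 0 at [w = 1/2]: [(1 - w^n)^m] is close to
   [exp (- m w^n)], and [m w^n = n (2w)^n]. *)
Lemma cvg_step_poly w : 0 <= w <= 1 ->
  (1 - w ^+ n) ^+ (n * 2 ^ n) @[n --> \oo] --> ((w < 1 / 2)%R%:R : R).
Proof.
move=> /andP[w0 w1].
have wn n : 0 <= w ^+ n <= 1 by rewrite exprn_ge0 //= exprn_ile1.
have wn1 n : 0 <= 1 - w ^+ n by have /andP[] := wn n; rewrite subr_ge0.
have mE n : (n * 2 ^ n)%:R * w ^+ n = n%:R * (2 * w) ^+ n.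
  by rewrite natrM natrX exprMn mulrA.
case: ltP => hw.
  (* Here [2 * w < 1], so the lower bound from Bernoulli's inequality tends to 1. *)
  apply: (squeeze_cvgr (f := (fun n => 1 - n%:R * (2 * w) ^+ n)) (h := (cst 1))).
  - apply: nearW => n; rewrite -mE bernoulli_ge //=.
    by rewrite exprn_ile1 // lerBlDr lerDl; have /andP[] := wn n.
  - rewrite -[X in _ --> X]subr0; apply: cvgB; first exact: cvg_cst.
    by apply: cvg_natmul_geometric; lra.
  - exact: cvg_cst.
(* Here [(2 * w) ^+ n >= 1], and [bernoulli_le] bounds the power by [1 / (n + 1)]. The point
   [w = 1/2] belongs to this case, hence the strict inequality in the limit. *)
apply: (squeeze_cvgr (f := (cst 0)) (h := (@harmonic R))).
- apply: nearW => n; rewrite exprn_ge0 //= /harmonic /=.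
  rewrite -[X in _ <= X]mul1r ler_pdivlMr //.
  apply: le_trans (@bernoulli_le _ (n * 2 ^ n) (wn n)).
  rewrite ler_wpM2l ?exprn_ge0 // mE -natr1 addrC lerD2l.
  by rewrite ler_peMr // exprn_ege1 //; lra.
- exact: cvg_cst.
- exact: cvg_harmonic.
Qed.

End step_polynomials.

(** * From vanishing moments to vanishing integrals against indicators *)

Section determinacy.
Context {d : measure_display} {T : measurableType d} {R : realType}.
Variable mu : {measure set T -> \bar R}.
Implicit Types f g u : T -> R.

(** An increasing affine map sends [[-M, M]] into [[0, 1]] and [c] to [1/2]; composed with it, the
    step polynomials converge boundedly to the indicator of the ray. *)
Lemma moments0_ray u f (c : R) : bounded_mfun u -> Rintegrable mu f ->
  (forall k, \int[mu]_y (u y ^+ k * f y) = 0) ->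
  \int[mu]_y (\1_(`]-oo, c[%classic) (u y) * f y) = 0.
Proof.
move=> [mu_ [M0 uM0]] fi m0.
(* The summand [|c|] ensures [|x - c| <= 2 * M], which keeps [w] in [[0, 1]]; the summand 1 makes
   [M] positive. *)
pose M := 1 + `|M0| + `|c|.
have M_gt0 : 0 < M by rewrite /M -addrA ltr_wpDr // addr_ge0.
have uM y : `|u y| <= M.
  rewrite (le_trans (uM0 y)) // (le_trans (ler_norm _)) // /M.
  by rewrite addrAC lerDr addr_ge0.
pose w x := 1 / 2 + (x - c) / (4 * M).
have w01 x : `|x| <= M -> 0 <= w x <= 1.
  move=> xM; have xc : `|x - c| <= 2 * M.
    rewrite (le_trans (ler_normB _ _)) // mulrDl mul1r lerD // /M.
    by rewrite lerDr addr_ge0.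
  have : `|(x - c) / (4 * M)| <= 1 / 2.
    rewrite normrM normfV (gtr0_norm (_ : 0 < 4 * M)) ?mulr_gt0 //.
    rewrite ler_pdivrMr ?mulr_gt0 // (le_trans xc) // mulrA ler_wpM2r ?(ltW M_gt0) //.
    by lra.
  by rewrite ler_norml /w => /andP[]; set e := ((x - c) / _) => ? ?; lra.
have wlt x : (w x < 1 / 2) = (x < c).
  rewrite /w gtrDl pmulr_llt0 ?subr_lt0 // invr_gt0 mulr_gt0 //.
pose W : {poly R} := (1 / 2 - c / (4 * M))%:P + (4 * M)^-1 *: 'X.
have WE x : W.[x] = w x.
  by rewrite /W !hornerE /w mulrBl; ring.
pose p n : {poly R} := (1 - W ^+ n) ^+ (n * 2 ^ n).
have pE n x : (p n).[x] = (1 - w x ^+ n) ^+ (n * 2 ^ n).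
  by rewrite /p -WE !horner_exp hornerD hornerN horner_exp hornerC.
apply: (@moments0_poly_lim _ _ _ mu u f M 1 p (\1_(`]-oo, c[%classic))) => //.
- move=> n x /w01 /andP[x0 x1]; rewrite pE.
  have h0 : 0 <= 1 - w x ^+ n by rewrite subr_ge0 exprn_ile1.
  by rewrite ger0_norm ?exprn_ge0 // exprn_ile1 // lerBlDr lerDl exprn_ge0.
- move=> x /w01 xM; under eq_fun do rewrite pE.
  have -> : \1_(`]-oo, c[%classic) x = (w x < 1 / 2)%R%:R :> R.
    by rewrite wlt indicE mem_setE in_itv.
  exact: cvg_step_poly.
Qed.

(** A pi-lambda argument: the sets with vanishing integral are closed under proper differences by
    linearity and under increasing unions by dominated convergence. The map [g] lets the lemma serve
    both rays on the line and rectangles in the plane. *)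
Lemma Rintegral_indic_pi_lambda (d' : measure_display) (T' : measurableType d')
    (g : T -> T') f (G : set (set T')) :
  measurable_fun setT g -> Rintegrable mu f ->
  setI_closed G -> measurable = <<s G >> -> \int[mu]_y f y = 0 ->
  (forall A, G A -> \int[mu]_y (\1_A (g y) * f y) = 0) ->
  forall A, measurable A -> \int[mu]_y (\1_A (g y) * f y) = 0.
Proof.
move=> mg fi GI GE f0 G0.
pose H := [set A : set T' | measurable A /\ \int[mu]_y (\1_A (g y) * f y) = 0].
have bi A : measurable A -> Rintegrable mu (fun y => \1_A (g y) * f y).
  by move=> mA; apply: RintegrableM => //; exact: bounded_mfun_indic.
suff sub : <<s G >> `<=` H by move=> A; rewrite GE => /sub[].
apply: lambda_system_subset => //; last first.
  by move=> A GA; split; [rewrite GE; exact: sub_sigma_algebra|exact: G0].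
split => //.
- split; first exact: measurableT.
  by under eq_Rintegral do rewrite indicT mul1r.
- move=> A B BA [mA A0] [mB B0]; split; first exact: measurableD.
  have <- : \int[mu]_y (\1_A (g y) * f y - \1_B (g y) * f y) = 0.
    by rewrite (RintegralB _ (bi _ mA) (bi _ mB)) // A0 B0 subrr.
  apply: eq_Rintegral => y _; rewrite -mulrBl; congr (_ * _).
  rewrite !indicE in_setD; have [yB|yB] := boolP (g y \in B).
    have -> : g y \in A by apply/mem_set/BA/set_mem.
    by rewrite subrr andbF.
  by rewrite subr0 andbT.
- move=> F ndF HF; split.
    by apply: bigcupT_measurable => i; have [] := HF i.
  apply: (@Rdominated_eq0 _ _ _ mu (fun n y => \1_(F n) (g y) * f y) _
    (fun y => `|f y|)).
  + by move=> n; apply: Rintegrable_measurable; apply: bi; have [] := HF n.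
  + exact: integrable_norm.
  + move=> n y; rewrite normrM ler_piMl // indicE.
    by case: (_ \in _); rewrite ?normr1 ?normr0.
  + move=> y; apply: cvgMl; have [[N _ FN]|yF] := pselect ((\bigcup_i F i) (g y)).
      apply: cvg_near_cst; near=> n.
      have Fn : F n (g y).
        have Nn : (N <= n)%N by near: n; exact: nbhs_infty_ge.
        by move: FN; exact/subsetPset/ndF.
      by rewrite !indicE !mem_set //; exists N.
    rewrite indicE memNset //; apply: cvg_near_cst; apply: nearW => n.
    by rewrite indicE memNset // => Fn; apply: yF; exists n.
  + by move=> n; have [] := HF n.
Unshelve. all: by end_near. Qed.

(** The rays of [moments0_ray] form a pi-system that generates the Borel sets. *)
Lemma moments0_indic u f (A : set R) : bounded_mfun u ->
  Rintegrable mu f -> (forall k, \int[mu]_y (u y ^+ k * f y) = 0) ->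
  measurable A -> \int[mu]_y (\1_A (u y) * f y) = 0.
Proof.
move=> bu fi m0; move: A.
apply: (@Rintegral_indic_pi_lambda _ _ u f (@RGenInftyO.G R)) => //.
- by case: bu.
- move=> A B [x ->] [y ->]; exists (Num.min x y).
  by apply/seteqP; split => z /=; rewrite !in_itv /= lt_min; [case=> -> ->|move/andP].
- exact: RGenInftyO.measurableE.
- by rewrite -[RHS](m0 0%N); under [RHS]eq_Rintegral do rewrite mul1r.
- by move=> A [x ->]; exact: moments0_ray.
Qed.

End determinacy.

(** * From trigonometric integrals on an interval of wave numbers to moments *)

Section trigonometric_moments.
Context {d : measure_display} {T : measurableType d} {R : realType}.
Variable mu : {measure set T -> \bar R}.
Implicit Types f g u s a b : T -> R.

Lemma lipschitz1_derive (g dg : R -> R) :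
  (forall x : R, is_derive x 1 g (dg x)) -> (forall x, `|dg x| <= 1) ->
  forall x y, `|g x - g y| <= `|x - y|.
Proof.
move=> gd dg1 x y; wlog xy : x y / x < y => [hw|].
  have [/hw //|/hw|->] := ltgtP x y; first by rewrite distrC (distrC y).
  by rewrite !subrr.
have [c _] : exists2 c, c \in `]x, y[%R & g y - g x = dg c * (y - x).
  apply: MVT => //.
  apply: continuous_subspaceT => z; apply/differentiable_continuous.
  by apply/derivable1_diffP; have [] := gd z.
by rewrite distrC (distrC x) => ->; rewrite normrM ler_piMl.
Qed.

(** Increments run along a sequence, as [Rdominated_eq0] requires. *)
Lemma cvg_difference_quotient (g dg : R -> R) (t s : R) (h : nat -> R) :
  (forall x : R, is_derive x 1 g (dg x)) ->
  (forall n, h n != 0) -> h n @[n --> \oo] --> 0 ->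
  (h n)^-1 * (g ((t + h n) * s) - g (t * s)) @[n --> \oo] --> dg (t * s) * s.
Proof.
move=> gd hn0 h0.
have [] : is_derive t 1 (g \o (fun x => x * s)) (dg (t * s) * s).
  apply: is_derive1_comp.
  rewrite [X in is_derive _ _ X _](_ : _ = s \*: (@id R)).
    by apply: is_derive_eq; rewrite /GRing.scale /= mulr1.
  by apply/funext => x /=; rewrite mulrC.
move=> /cvg_ex[l hl] hd; have {hl} : (k : R)^-1 *: (g ((k *: 1 + t) * s) - g (t * s))
   @[k --> 0^'] --> dg (t * s) * s.
  rewrite -hd /derive /=.
  by apply: cvgP; exact: hl.
move/cvgr_dnbhsP => /(_ h (conj hn0 h0)).
apply: cvg_trans; apply: near_eq_cvg; apply: nearW => n /=.
by rewrite /GRing.scale /= mulr1 (addrC t).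
Qed.

(** Differentiation under the integral sign. Since [cos] and [sin] are 1-Lipschitz and [|s| <= M],
    the difference quotients are dominated by [M * |a| + M * |b|]. *)
Lemma trig_integral_derive s a b (t1 t2 : R) : bounded_mfun s ->
  Rintegrable mu a -> Rintegrable mu b ->
  (forall t, t1 < t < t2 ->
    \int[mu]_y (cos (t * s y) * a y + sin (t * s y) * b y) = 0) ->
  forall t, t1 < t < t2 ->
    \int[mu]_y (cos (t * s y) * (s y * b y) - sin (t * s y) * (s y * a y)) = 0.
Proof.
move=> [ms [M sM]] ai bi E0 t /andP[t1t tt2].
(* With [n.+1] the first point [t + h 0] would be [t2], outside the open interval. *)
pose h n := (t2 - t) / n.+2%:R.
have h_gt0 n : 0 < h n by rewrite divr_gt0 ?subr_gt0.
have hn0 n : h n != 0 by rewrite gt_eqF.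
have h0 : h n @[n --> \oo] --> (0 : R).
  rewrite -[X in _ --> X](mulr0 (t2 - t)); apply: cvgMr.
  have := @cvg_harmonic R; rewrite -cvg_shiftS /harmonic /=; exact.
have ht n : t1 < t + h n < t2.
  rewrite (lt_le_trans t1t) ?lerDl ?ltW //= -ltrBrDl /h.
  rewrite ltr_pdivrMr // ltr_pMr ?subr_gt0 // ltr1n //.
have mts (c : R) : measurable_fun setT (fun y => c * s y) by exact: measurable_funM.
have Ei c : Rintegrable mu (fun y => cos (c * s y) * a y + sin (c * s y) * b y).
  apply: RintegrableD; apply: RintegrableM => //.
    exact: bounded_mfun_cos.
  exact: bounded_mfun_sin.
pose Q n y := (h n)^-1 * (cos ((t + h n) * s y) - cos (t * s y)) * a y +
              (h n)^-1 * (sin ((t + h n) * s y) - sin (t * s y)) * b y.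
have QE n y : Q n y = (h n)^-1 *
   ((cos ((t + h n) * s y) * a y + sin ((t + h n) * s y) * b y) -
    (cos (t * s y) * a y + sin (t * s y) * b y)) by rewrite /Q; ring.
have Dc : forall x : R, is_derive x 1 cos (- sin x) by move=> x; exact: is_derive_cos.
have Ds : forall x : R, is_derive x 1 sin (cos x) by move=> x; exact: is_derive_sin.
have Qi n : Rintegrable mu (Q n).
  rewrite (funext (QE n)); exact/RintegrableZ/RintegrableB.
have lip (g dg : R -> R) : (forall x : R, is_derive x 1 g (dg x)) ->
    (forall x, `|dg x| <= 1) -> forall n y,
    `|(h n)^-1 * (g ((t + h n) * s y) - g (t * s y))| <= M.
  move=> gd g1 n y; rewrite normrM normfV (gtr0_norm (h_gt0 n)) mulrC.
  rewrite ler_pdivrMr //.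
  rewrite (le_trans (lipschitz1_derive _ _ gd g1 _ _)) //.
  by rewrite -mulrBl addrAC subrr add0r normrM (gtr0_norm (h_gt0 n)) mulrC ler_pM2r.
apply: (@Rdominated_eq0 _ _ _ mu Q _ (fun y => M * `|a y| + M * `|b y|)).
- by move=> n; exact: Rintegrable_measurable.
- by apply: RintegrableD; apply: RintegrableZ; exact: integrable_norm.
- move=> n y; rewrite (le_trans (ler_normD _ _)) // !normrM -!normrM.
  rewrite lerD // normrM ler_wpM2r //.
    by apply: lip Dc _ _ _ => x; rewrite normrN sin_max.
  by apply: lip Ds _ _ _ => x; rewrite cos_max.
- move=> y; rewrite [X in _ --> X](_ : _ =
    - sin (t * s y) * s y * a y + cos (t * s y) * s y * b y); last by ring.
  apply: cvgD; apply: cvgMl.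
    exact: (cvg_difference_quotient _ _ _ _ _ Dc).
  exact: (cvg_difference_quotient _ _ _ _ _ Ds).
- move=> n; under eq_Rintegral do rewrite QE.
  rewrite (RintegralZl _ _ (RintegrableB mu _ _ (Ei _) (Ei _))) //.
  rewrite (RintegralB _ (Ei _) (Ei _)) // !E0 ?t1t // ?subrr ?mulr0 //.
Qed.

(** The hypotheses concern the real and imaginary parts of [\int exp(-i t s) (a + i b)].
    Differentiating at one [t0] kills all moments of [exp(-i t0 s) (a + i b)]; multiplying by the
    power series of [exp(i t0 s)] then removes the phase, which replaces analytic continuation to
    0. *)
Lemma trig_integral_moments s a b (t1 t2 : R) : t1 < t2 -> bounded_mfun s ->
  Rintegrable mu a -> Rintegrable mu b ->
  (forall t, t1 < t < t2 ->
    \int[mu]_y (cos (t * s y) * a y + sin (t * s y) * b y) = 0) ->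
  (forall t, t1 < t < t2 ->
    \int[mu]_y (cos (t * s y) * b y - sin (t * s y) * a y) = 0) ->
  forall n, \int[mu]_y (s y ^+ n * a y) = 0 /\ \int[mu]_y (s y ^+ n * b y) = 0.
Proof.
move=> t12 bs ai bi E0 E1.
have si n f : Rintegrable mu f -> Rintegrable mu (fun y => s y ^+ n * f y).
  by move=> fi; apply: RintegrableM => //; exact: bounded_mfunX.
have mts (c : R) : measurable_fun setT (fun y => c * s y).
  by apply: measurable_funM => //; case: bs.
have bc t := bounded_mfun_cos _ (mts t).
have bsn t := bounded_mfun_sin _ (mts t).
have Nint f : Rintegrable mu f -> \int[mu]_y (- f y) = - \int[mu]_y f y.
  move=> fi; rewrite -mulN1r -(RintegralZl _ measurableT fi).
  by apply: eq_Rintegral => y _; rewrite mulN1r.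
(* A derivative in [t] turns the first identity into the second for [n.+1], and the second into
   minus the first, so the induction carries both. *)
have step n : (forall t, t1 < t < t2 -> \int[mu]_y (cos (t * s y) *
      (s y ^+ n * a y) + sin (t * s y) * (s y ^+ n * b y)) = 0) /\
    (forall t, t1 < t < t2 -> \int[mu]_y (cos (t * s y) *
      (s y ^+ n * b y) - sin (t * s y) * (s y ^+ n * a y)) = 0).
  elim: n => [|n [IH0 IH1]].
    by split=> t ht; [rewrite -[RHS](E0 t ht)|rewrite -[RHS](E1 t ht)];
       apply: eq_Rintegral => y _; rewrite !mul1r.
  split=> t ht.
    have := @trig_integral_derive s (fun y => s y ^+ n * b y)
      (fun y => - (s y ^+ n * a y)) t1 t2 bs (si n b bi).
    have ani : Rintegrable mu (fun y => - (s y ^+ n * a y)).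
      under eq_fun do rewrite -mulN1r.
      exact/RintegrableZ/si.
    move=> /(_ ani) h; rewrite -[RHS]oppr0 -(h _ t ht).
      rewrite -Nint; last first.
        apply: RintegrableB; apply: RintegrableM => //;
        by apply: RintegrableM => //; exact: si.
      by apply: eq_Rintegral => y _; rewrite exprS; ring.
    by move=> t' ht'; rewrite -[RHS](IH1 t' ht'); apply: eq_Rintegral => y _; ring.
  rewrite -(trig_integral_derive _ _ _ _ _ bs (si n a ai) (si n b bi) IH0 t ht).
  by apply: eq_Rintegral => y _; rewrite exprS; ring.
pose t0 := (t1 + t2) / 2.
have t0in : t1 < t0 < t2 by rewrite /t0; lra.
(* [al] and [be] are the real and imaginary parts of [exp(-i t0 s) (a + i b)]. *)
pose al y := cos (t0 * s y) * a y + sin (t0 * s y) * b y.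
pose be y := cos (t0 * s y) * b y - sin (t0 * s y) * a y.
have ali : Rintegrable mu al by apply: RintegrableD; exact: RintegrableM.
have bei : Rintegrable mu be by apply: RintegrableB; exact: RintegrableM.
have al0 k : \int[mu]_y (s y ^+ k * al y) = 0.
  rewrite -[RHS]((step k).1 t0 t0in); apply: eq_Rintegral => y _.
  by rewrite /al; ring.
have be0 k : \int[mu]_y (s y ^+ k * be y) = 0.
  rewrite -[RHS]((step k).2 t0 t0in); apply: eq_Rintegral => y _.
  by rewrite /be; ring.
move=> n.
have shift f : (forall k, \int[mu]_y (s y ^+ k * f y) = 0) ->
    forall k, \int[mu]_y (s y ^+ k * (s y ^+ n * f y)) = 0.
  move=> f0 k; rewrite -[RHS](f0 (k + n)%N); apply: eq_Rintegral => y _.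
  by rewrite exprD mulrA.
have [al1 al2] := moments0_cos_sin mu s _ t0 bs (si n _ ali) (shift _ al0).
have [be1 be2] := moments0_cos_sin mu s _ t0 bs (si n _ bei) (shift _ be0).
have ci f : Rintegrable mu f ->
    Rintegrable mu (fun y => cos (t0 * s y) * (s y ^+ n * f y)).
  by move=> fi; apply: RintegrableM => //; exact: si.
have sni f : Rintegrable mu f ->
    Rintegrable mu (fun y => sin (t0 * s y) * (s y ^+ n * f y)).
  by move=> fi; apply: RintegrableM => //; exact: si.
(* Undoing the rotation: [cos * al - sin * be] is [a], and [sin * al + cos * be] is [b]. *)
split.
- rewrite -[RHS](subrr 0) -{1}al1 -{1}be2.
  rewrite -(RintegralB _ (ci _ ali) (sni _ bei)) //; apply: eq_Rintegral => y _.
  rewrite -[LHS]mul1r -(cos2Dsin2 (t0 * s y)) /al /be; ring.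
- rewrite -[RHS](addr0 0) -{1}al2 -{1}be1.
  rewrite -(RintegralD _ (sni _ ali) (ci _ bei)) //; apply: eq_Rintegral => y _.
  rewrite -[LHS]mul1r -(cos2Dsin2 (t0 * s y)) /al /be; ring.
Qed.

End trigonometric_moments.

(** * Moments as polynomials in the direction of observation *)

Section directional_moments.
Context {d : measure_display} {T : measurableType d} {R : realType}.
Variable mu : {measure set T -> \bar R}.
Implicit Types f g u v a b : T -> R.

(** The points [e / (i + 2)], all strictly below [e], give [size p] distinct roots, more than the
    degree allows. *)
Lemma poly_vanish_near0 (p : {poly R}) (e : R) : 0 < e ->
  (forall r, `|r| < e -> p.[r] = 0) -> p = 0.
Proof.
move=> e0 pe; pose rs := [seq e / i.+2%:R | i <- iota 0 (size p)].
apply: (@roots_geq_poly_eq0 _ p rs).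
- apply/allP => _ /mapP[i _ ->]; apply/eqP/pe.
  by rewrite ger0_norm ?divr_ge0 ?ltW // ltr_pdivrMr // ltr_pMr // ltr1n.
- rewrite map_inj_uniq ?iota_uniq // => i j.
  by move/(mulfI (lt0r_neq0 e0))/invr_inj/eqP; rewrite eqr_nat => /eqP[].
- by rewrite size_map size_iota.
Qed.

(** The binomial expansion of [\int (u + r v)^n f] in powers of [r]; its coefficients carry the
    mixed moments of degree [n]. *)
Definition dir_poly u v f n : {poly R} :=
  \poly_(k < n.+1) ('C(n, k)%:R * \int[mu]_y (u y ^+ (n - k) * v y ^+ k * f y)).

Lemma horner_dir_poly u v f n r :
  bounded_mfun u -> bounded_mfun v -> Rintegrable mu f ->
  (dir_poly u v f n).[r] = \int[mu]_y ((u y + r * v y) ^+ n * f y).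
Proof.
move=> bu bv fi; rewrite horner_poly.
have uvi k : Rintegrable mu (fun y => u y ^+ (n - k) * v y ^+ k * f y).
  by apply: RintegrableM => //; apply: bounded_mfunM; exact: bounded_mfunX.
transitivity (\int[mu]_y (\sum_(k < n.+1) ('C(n, k)%:R * r ^+ k) *
    (u y ^+ (n - k) * v y ^+ k * f y))).
  rewrite (Rintegral_sum mu _ (fun k y => ('C(n, k)%:R * r ^+ k) *
    (u y ^+ (n - k) * v y ^+ k * f y))); last by move=> k; exact/RintegrableZ.
  apply: eq_bigr => k _; rewrite (RintegralZl _ _ (uvi k)) //.
  by rewrite mulrAC.
apply: eq_Rintegral => y _; rewrite exprDn mulr_suml; apply: eq_bigr => k _.
by rewrite exprMn -mulr_natl; ring.
Qed.

Lemma dir_poly0_moments u v f n : dir_poly u v f n = 0 ->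
  forall k, (k <= n)%N -> \int[mu]_y (u y ^+ (n - k) * v y ^+ k * f y) = 0.
Proof.
move=> p0 k kn; have := coef_poly n.+1
  (fun k => 'C(n, k)%:R * \int[mu]_y (u y ^+ (n - k) * v y ^+ k * f y)) k.
rewrite -[\poly_(_ < _) _]/(dir_poly u v f n) p0 coef0 ltnS kn => /esym/eqP.
by rewrite mulf_eq0 pnatr_eq0 -leqn0 leqNgt bin_gt0 kn => /eqP.
Qed.

(** The integral is a polynomial in [r]: the [dir_poly] of [a] plus ['X] times that of [b]. *)
Lemma dir_moments_line u v a b n e :
  bounded_mfun u -> bounded_mfun v -> Rintegrable mu a -> Rintegrable mu b ->
  0 < e ->
  (forall r, `|r| < e ->
    \int[mu]_y ((u y + r * v y) ^+ n * (a y + r * b y)) = 0) ->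
  forall r, \int[mu]_y ((u y + r * v y) ^+ n * (a y + r * b y)) = 0.
Proof.
move=> bu bv ai bi e0 H.
pose p := dir_poly u v a n + 'X * dir_poly u v b n.
have bw r : bounded_mfun (fun y => (u y + r * v y) ^+ n).
  by apply: bounded_mfunX; apply: bounded_mfunD => //; exact: bounded_mfunZ.
have pE r : p.[r] = \int[mu]_y ((u y + r * v y) ^+ n * (a y + r * b y)).
  rewrite /p hornerD hornerM hornerX !horner_dir_poly //.
  have wai : Rintegrable mu (fun y => (u y + r * v y) ^+ n * a y) by exact: RintegrableM.
  have wbi : Rintegrable mu (fun y => (u y + r * v y) ^+ n * b y) by exact: RintegrableM.
  rewrite -(RintegralZl r measurableT wbi).
  rewrite -(RintegralD measurableT wai (RintegrableZ mu _ _ wbi)).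
  by apply: eq_Rintegral => y _; ring.
have p0 : p = 0 by apply: (poly_vanish_near0 _ e) => // r re; rewrite pE H.
by move=> r; rewrite -pE p0 horner0.
Qed.

(* The cone over [Sq q] contains a neighbourhood of [q], and every [x] lies on
   a line through [q]. *)
Lemma dir_moments_cone u v a1 a2 n (q : pt R) :
  bounded_mfun u -> bounded_mfun v -> Rintegrable mu a1 -> Rintegrable mu a2 ->
  unit_circle q ->
  (forall x, Sq q x -> \int[mu]_y
    ((x.1 * u y + x.2 * v y) ^+ n * (x.1 * a1 y + x.2 * a2 y)) = 0) ->
  forall x : pt R, \int[mu]_y
    ((x.1 * u y + x.2 * v y) ^+ n * (x.1 * a1 y + x.2 * a2 y)) = 0.
Proof.
move=> bu bv a1i a2i q1 H.
have blin c1 c2 : bounded_mfun (fun y => c1 * u y + c2 * v y).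
  by apply: bounded_mfunD; exact: bounded_mfunZ.
have ilin c1 c2 : Rintegrable mu (fun y => c1 * a1 y + c2 * a2 y).
  by apply: RintegrableD; exact: RintegrableZ.
(* The integral is homogeneous of degree [n + 1] in [x], so it vanishes on the whole cone
   [|x| <= 2 q.x] over [Sq q], here in squared form. *)
have Hcone (x : pt R) : 0 < dot q x -> dot x x <= 4 * dot q x ^+ 2 -> \int[mu]_y
    ((x.1 * u y + x.2 * v y) ^+ n * (x.1 * a1 y + x.2 * a2 y)) = 0.
  move=> qx0 xx.
  have nx0 : 0 < dot x x.
    rewrite lt0r; apply/andP; split; last by rewrite addr_ge0 // -expr2 sqr_ge0.
    apply: contraTN qx0; rewrite /dot paddr_eq0 -?expr2 ?sqr_ge0 // !sqrf_eq0.
    by move=> /andP[/eqP-> /eqP->]; rewrite !mulr0 addr0 ltxx.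
  pose N := Num.sqrt (dot x x).
  have N0 : 0 < N by rewrite sqrtr_gt0.
  have NE : N ^+ 2 = dot x x by rewrite sqr_sqrtr // ltW.
  have := H (x.1 / N, x.2 / N); rewrite /Sq /unit_circle /=.
  have -> : dot (x.1 / N, x.2 / N) (x.1 / N, x.2 / N) = 1.
    have -> : dot (x.1 / N, x.2 / N) (x.1 / N, x.2 / N) = dot x x / N ^+ 2.
      by rewrite /dot /= expr2 invfM; ring.
    by rewrite NE divff // gt_eqF.
  have -> : dot q (x.1 / N, x.2 / N) = dot q x / N by rewrite /dot /=; ring.
  have qN : 1 / 2 <= dot q x / N.
    rewrite ler_pdivlMr // mul1r mulrC ler_pdivrMr // /N.
    have q20 : 0 <= dot q x * 2 by rewrite mulr_ge0 // ltW.
    rewrite -(ger0_norm q20) -sqrtr_sqr ler_wsqrtr // (le_trans xx) //.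
    by rewrite le_eqVlt; apply/orP; left; apply/eqP; ring.
  move=> /(_ (conj erefl qN)) h0.
  have wi : Rintegrable mu (fun y => (x.1 / N * u y + x.2 / N * v y) ^+ n *
      (x.1 / N * a1 y + x.2 / N * a2 y)).
    by apply: RintegrableM => //; exact: bounded_mfunX.
  rewrite -[RHS](mulr0 (N ^+ n.+1)) -h0 -(RintegralZl _ measurableT wi).
  apply: eq_Rintegral => y _; rewrite exprSr.
  have Nn0 : N != 0 by rewrite gt_eqF.
  rewrite mulrACA -exprMn; congr (_ ^+ n * _); by field.
move=> x; pose dx : pt R := (x.1 - q.1, x.2 - q.2).
(* For [|r| < 1 / (4 K)] both [|r q.dx|] and [r^2 |dx|^2] are at most [1/4], which keeps [q + r dx]
   in the cone. *)
pose K := 1 + `|dot q dx| + dot dx dx.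
have dd0 : 0 <= dot dx dx by rewrite addr_ge0 // -expr2 sqr_ge0.
have K1 : 1 <= K by rewrite /K -addrA lerDl addr_ge0.
have K0 : 0 < K by exact: lt_le_trans K1.
have := @dir_moments_line (fun y => q.1 * u y + q.2 * v y)
  (fun y => dx.1 * u y + dx.2 * v y) (fun y => q.1 * a1 y + q.2 * a2 y)
  (fun y => dx.1 * a1 y + dx.2 * a2 y) n (4 * K)^-1 (blin _ _) (blin _ _)
  (ilin _ _) (ilin _ _).
have e0 : 0 < (4 * K)^-1 by rewrite invr_gt0 mulr_gt0.
move=> /(_ e0) h; rewrite -[RHS](h _ 1).
  by apply: eq_Rintegral => y _; rewrite /dx /=; congr (_ ^+ n * _); ring.
move=> r re.
have rK : `|r| * K <= 1 / 4.
  by rewrite -ler_pdivlMr // (le_trans (ltW re)) // invfM div1r mulrC.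
have rA : `|r * dot q dx| <= 1 / 4.
  rewrite normrM (le_trans _ rK) // ler_wpM2l // /K addrAC lerDr.
  by rewrite addr_ge0.
have {}rA : - (1 / 4) <= r * dot q dx <= 1 / 4 by rewrite -ler_norml.
have rD : r ^+ 2 * dot dx dx <= 1 / 4.
  have r1 : `|r| <= 1.
    rewrite (le_trans _ (_ : 1 / 4 <= 1)) //; last by lra.
    by rewrite (le_trans _ rK) // ler_peMr.
  rewrite -real_normK ?num_real // expr2 -mulrA (le_trans _ rK) //.
  rewrite (le_trans (ler_piMl _ r1)) ?mulr_ge0 //.
  by rewrite ler_wpM2l // /K lerDr addr_ge0.
rewrite -[RHS](Hcone (q.1 + r * dx.1, q.2 + r * dx.2)).
- by apply: eq_Rintegral => y _ /=; congr (_ ^+ n * _); ring.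
- have -> : dot q (q.1 + r * dx.1, q.2 + r * dx.2) = dot q q + r * dot q dx.
    by rewrite /dot /=; ring.
  by rewrite q1; lra.
- have -> : dot q (q.1 + r * dx.1, q.2 + r * dx.2) = dot q q + r * dot q dx.
    by rewrite /dot /=; ring.
  have -> : dot (q.1 + r * dx.1, q.2 + r * dx.2) (q.1 + r * dx.1, q.2 + r * dx.2)
      = dot q q + 2 * (r * dot q dx) + r ^+ 2 * dot dx dx.
    by rewrite /dot /=; ring.
  (* With [A = r q.dx] the claim reads [r^2 |dx|^2 <= 3 + 6 A + 4 A^2], and [A >= -1/4] makes the
     right side at least [3/2]. *)
  rewrite q1; have := sqr_ge0 (r * dot q dx); nra.
Qed.

(** For the direction [(1, r)], let [P] and [Q] be the moments of [a1] and [a2]. The two kinds of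
    data give [P + r Q = 0] and [- r P + Q = 0], a system of determinant [1 + r^2]. So both vanish
    for all [r], and with them the coefficients of their [dir_poly]. *)
Lemma vector_moments u v a1 a2 n (q : pt R) :
  bounded_mfun u -> bounded_mfun v -> Rintegrable mu a1 -> Rintegrable mu a2 ->
  unit_circle q ->
  (forall x, Sq q x -> \int[mu]_y
    ((x.1 * u y + x.2 * v y) ^+ n * (x.1 * a1 y + x.2 * a2 y)) = 0) ->
  (forall x, Sq_perp q x -> \int[mu]_y
    ((x.1 * u y + x.2 * v y) ^+ n * (- x.2 * a1 y + x.1 * a2 y)) = 0) ->
  forall k, (k <= n)%N ->
    \int[mu]_y (u y ^+ (n - k) * v y ^+ k * a1 y) = 0 /\
    \int[mu]_y (u y ^+ (n - k) * v y ^+ k * a2 y) = 0.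
Proof.
move=> bu bv a1i a2i q1 Hp Hs.
have bNv : bounded_mfun (fun y => -1 * v y) by exact: bounded_mfunZ.
have {}Hp := dir_moments_cone u v a1 a2 n q bu bv a1i a2i q1 Hp.
(* Expressed through [perp x], the shear condition becomes a compressional one with coordinates
   [(- v, u)], so [dir_moments_cone] applies again. *)
have {}Hs : forall x : pt R, \int[mu]_y ((x.1 * (-1 * v y) + x.2 * u y) ^+ n *
    (x.1 * a1 y + x.2 * a2 y)) = 0.
  apply: (dir_moments_cone _ _ _ _ n q bNv bu a1i a2i q1) => x [x1 xq].
  rewrite -[RHS](Hs (x.2, - x.1)).
    by apply: eq_Rintegral => y _ /=; congr (_ ^+ n * _); ring.
  by split; rewrite /unit_circle /dot /perp /= ?opprK // -x1 /dot; ring.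
have bw r : bounded_mfun (fun y => (u y + r * v y) ^+ n).
  by apply: bounded_mfunX; apply: bounded_mfunD => //; exact: bounded_mfunZ.
have wi r f : Rintegrable mu f ->
    Rintegrable mu (fun y => (u y + r * v y) ^+ n * f y).
  by move=> fi; exact: RintegrableM.
have sq r : 1 + r * r != 0 :> R by rewrite gt_eqF // ltr_wpDr // -expr2 sqr_ge0.
pose P r := \int[mu]_y ((u y + r * v y) ^+ n * a1 y).
pose Q r := \int[mu]_y ((u y + r * v y) ^+ n * a2 y).
have PQ1 r : P r + r * Q r = 0.
  rewrite /P /Q -(RintegralZl _ measurableT (wi r _ a2i)).
  rewrite -(RintegralD measurableT (wi r _ a1i) (RintegrableZ mu _ _ (wi r _ a2i))).
  rewrite -[RHS](Hp (1, r)); apply: eq_Rintegral => y _ /=.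
  by rewrite !mul1r; ring.
have PQ2 r : - r * P r + Q r = 0.
  rewrite /P /Q -(RintegralZl _ measurableT (wi r _ a1i)).
  rewrite -(RintegralD measurableT (RintegrableZ mu _ _ (wi r _ a1i)) (wi r _ a2i)).
  rewrite -[RHS](Hs (- r, 1)); apply: eq_Rintegral => y _ /=.
  have -> : - r * (-1 * v y) + 1 * u y = u y + r * v y by ring.
  by ring.
have P0 r : P r = 0.
  apply/eqP; rewrite -(mulrI_eq0 _ (mulfI (sq r))); apply/eqP.
  by rewrite -[RHS](subr0 0) -{1}(PQ1 r) -(mulr0 r) -(PQ2 r); ring.
have Q0 r : Q r = 0 by have := PQ2 r; rewrite P0 mulr0 add0r.
have D0 f : Rintegrable mu f ->
    (forall r, \int[mu]_y ((u y + r * v y) ^+ n * f y) = 0) ->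
    dir_poly u v f n = 0.
  move=> fi f0; apply: (poly_vanish_near0 _ 1) => // r _.
  by rewrite horner_dir_poly.
by move=> k kn; split; apply: dir_poly0_moments => //; exact: D0.
Qed.

End directional_moments.

(** * Compactly supported functions on the plane *)

Section planar_sources.
Context {R : realType}.
(* [pt R] as the measurable space carrying [leb2 R]: the canonical instance on
   [R * R] has the same measurable sets but another display. *)
Local Notation mpt := (measurableTypeR R * measurableTypeR R)%type.
Implicit Types f g : mpt -> R.

(** Truncated coordinates are bounded on the whole plane, as [bounded_mfun] demands, and unchanged
    where the sources live. *)
Definition clamp (M x : R) : R := Num.max (- M) (Num.min x M).

Lemma clamp_id M x : `|x| <= M -> clamp M x = x.
Proof. by rewrite ler_norml => /andP[? ?]; rewrite /clamp min_l ?max_r. Qed.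

Lemma norm_clamp_le M x : 0 <= M -> `|clamp M x| <= M.
Proof.
move=> M0; rewrite /clamp ler_norml le_max lexx /= ge_max ge_min lexx orbT andbT.
by rewrite (le_trans _ M0) // oppr_le0.
Qed.

Lemma bounded_mfun_clamp M (p : mpt -> R) : 0 <= M -> measurable_fun setT p ->
  bounded_mfun (fun y => clamp M (p y)).
Proof.
move=> M0 mp; split; last by exists M => y; exact: norm_clamp_le.
by apply: measurable_maxr => //; exact: measurable_minr.
Qed.

(** Powers are exchanged for indicators one coordinate at a time, which gives rectangles and then
    all measurable sets; a function with zero integral over each of them vanishes almost
    everywhere. *)
Lemma moments0_ae_eq0 (M : R) f : 0 <= M -> Rintegrable (@leb2 R) f ->
  (forall y, f y != 0 -> `|y.1| <= M /\ `|y.2| <= M) ->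
  (forall j k, \int[@leb2 R]_y (clamp M y.1 ^+ j * clamp M y.2 ^+ k * f y) = 0) ->
  {ae @leb2 R, forall y, f y = 0}.
Proof.
move=> M0 fi fM m0.
have bu : bounded_mfun (fun y : mpt => clamp M y.1).
  by apply: bounded_mfun_clamp => //; exact: measurable_fst.
have bv : bounded_mfun (fun y : mpt => clamp M y.2).
  by apply: bounded_mfun_clamp => //; exact: measurable_snd.
have h1 (A : set R) k : measurable A -> \int[@leb2 R]_y (clamp M y.2 ^+ k *
    (\1_A (clamp M y.1) * f y)) = 0.
  move=> mA.
  have vki : Rintegrable (@leb2 R) (fun y => clamp M y.2 ^+ k * f y).
    by apply: RintegrableM => //; exact: bounded_mfunX.
  rewrite -[RHS](moments0_indic _ _ _ A bu vki _ mA).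
    by apply: eq_Rintegral => y _; rewrite mulrCA.
  move=> j; rewrite -[RHS](m0 j k).
  by apply: eq_Rintegral => y _; rewrite mulrA.
have h2 (A B : set R) : measurable A -> measurable B -> \int[@leb2 R]_y (\1_B (clamp M y.2) *
    (\1_A (clamp M y.1) * f y)) = 0.
  move=> mA mB; apply: moments0_indic => //.
    apply: RintegrableM => //; apply: bounded_mfun_indic => //.
    by case: bu.
  by move=> k; exact: h1.
have h3 (E : set mpt) : measurable E -> \int[@leb2 R]_y (\1_E y * f y) = 0.
  apply: (@Rintegral_indic_pi_lambda _ _ _ (@leb2 R) _ _ id f
    [set A `*` B | A in measurable & B in measurable]) => //.
  - move=> X Y [X1 mX1 [X2 mX2 <-{X}]] [Y1 mY1 [Y2 mY2 <-{Y}]].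
    exists (X1 `&` Y1); first exact: measurableI.
    by exists (X2 `&` Y2); [exact: measurableI|rewrite setXI].
  - exact: measurable_prod_measurableType.
  - by rewrite -[RHS](m0 0%N 0%N); apply: eq_Rintegral => y _; rewrite !expr0 !mul1r.
  - move=> _ [A mA [B mB <-]]; rewrite -[RHS](h2 A B mA mB).
    (* Where [f] is nonzero the clamps have no effect. *)
    apply: eq_Rintegral => y _; have [->|fy0] := eqVneq (f y) 0.
      by rewrite !mulr0.
    have [y1 y2] := fM y fy0; rewrite !clamp_id // mulrA; congr (_ * _).
    by rewrite !indicE in_setX; case: (_ \in A); case: (_ \in B); rewrite ?mulr0 ?mulr1.
have : ae_eq (@leb2 R) setT (EFin \o f) (cst 0%E).
  apply: integral_ae_eq => //.
  move=> E _ mE; rewrite integral0 integral_mkcond restrict_EFin.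
  have -> : f \_ E = (fun y => \1_E y * f y).
    apply/funext => y; rewrite /patch indicE.
    by case: ifP; rewrite ?mul1r ?mul0r.
  have wi : Rintegrable (@leb2 R) (fun y => \1_E y * f y).
    apply: RintegrableM => //.
    exact: (bounded_mfun_indic _ _ id).
  rewrite -[LHS]fineK; last exact: integrable_fin_num.
  by have := h3 E mE; rewrite /Rintegral => ->.
by apply: filterS => y /(_ I) [].
Qed.

(** On a square of finite measure that contains the support, [|f| <= 1 + f^2 + g^2]. The pair [f],
    [g] stands for the real and imaginary parts, whose squares [L2c] integrates together. *)
Lemma square_integrable_Rintegrable (M : R) f g : 0 <= M ->
  measurable_fun setT f -> measurable_fun setT g ->
  (\int[@leb2 R]_y (f y ^+ 2 + g y ^+ 2)%:E < +oo)%E ->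
  (forall y, f y != 0 -> `|y.1| <= M /\ `|y.2| <= M) ->
  Rintegrable (@leb2 R) f.
Proof.
move=> M0 mf mg fg fM.
pose B : set mpt := `[- M, M]%classic `*` `[- M, M]%classic.
have mB : measurable B by apply: measurableX; exact: measurable_itv.
have Bfin : (@leb2 R B < +oo)%E.
  rewrite /leb2 product_measure1E //= !lebesgue_measure_itv /=.
  by case: ifP => _; rewrite ?mul0e // -EFinD -EFinM ltry.
have Bi : Rintegrable (@leb2 R) (\1_B).
  apply/integrableP; split; first by apply/measurable_EFinP; exact: measurable_indic.
  under eq_integral do rewrite /= ger0_norm //.
  by rewrite integral_indic // setIT.
have Si : Rintegrable (@leb2 R) (fun y => f y ^+ 2 + g y ^+ 2).
  apply/integrableP; split.
    by apply/measurable_EFinP; apply: measurable_funD; exact: measurable_funX.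
  under eq_integral do rewrite /= ger0_norm ?addr_ge0 ?sqr_ge0 //.
  exact: fg.
apply: (le_Rintegrable _ _ _ mf (RintegrableD _ _ _ Bi Si)) => y.
have [->|fy0] := eqVneq (f y) 0.
  by rewrite normr0 indicE expr0n /= add0r addr_ge0 ?sqr_ge0 //.
have [y1 y2] := fM y fy0.
have -> : \1_B y = 1 :> R.
  rewrite indicE mem_set // /B; split => /=; rewrite in_itv /= -ler_norml //.
have := sqr_ge0 (g y); rewrite -(real_normK (num_real (f y))).
have := normr_ge0 (f y); move: `|f y| => r r0 g0.
by nra.
Qed.

End planar_sources.

(** * Recovering a complex number from three moduli *)

Section phase_retrieval.
Context {R : realType}.

Lemma normc_eq_sq (x y : R[i]) : `|x| = `|y| ->
  complex.Re x ^+ 2 + complex.Im x ^+ 2 = complex.Re y ^+ 2 + complex.Im y ^+ 2.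
Proof.
rewrite !normc_def => -[/eqP]; rewrite eqr_sqrt ?addr_ge0 ?sqr_ge0 //.
by move/eqP.
Qed.

(** Expanding the squared moduli and subtracting the identity at [t1] leaves
    [Re ((a - b) conj(w) conj(tj - t1)) = 0] for [j = 2, 3]. So [(a - b) conj(w)] is orthogonal to
    two independent vectors of the plane and vanishes. *)
Lemma phase_retrieval (a b w t1 t2 t3 : R[i]) : w != 0 ->
  lin_indep_R (t2 - t1) (t3 - t1) ->
  (forall t, t \in [:: t1; t2; t3] -> `|a + t * w| = `|b + t * w|) -> a = b.
Proof.
move=> w0 lin H.
have h t : t \in [:: t1; t2; t3] -> _ := fun ht => normc_eq_sq _ _ (H t ht).
have := h t1; rewrite !inE eqxx => /(_ isT).
have := h t2; rewrite !inE eqxx orbT => /(_ isT).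
have := h t3; rewrite !inE eqxx !orbT => /(_ isT).
move: w0 lin {h H}; rewrite /lin_indep_R.
case: a b w t1 t2 t3 => [a1 a2] [b1 b2] [w1 w2] [p1 p2] [r1 r2] [s1 s2].
rewrite eq_complex /= => w0 lin h3 h2 h1.
(* [c1] and [c2] are the real and imaginary parts of [(a - b) conj(w)]. *)
set c1 := (a1 - b1) * w1 + (a2 - b2) * w2.
set c2 := (a2 - b2) * w1 - (a1 - b1) * w2.
have e2 : c1 * (r1 - p1) + c2 * (r2 - p2) = 0 by rewrite /c1 /c2; lra.
have e3 : c1 * (s1 - p1) + c2 * (s2 - p2) = 0 by rewrite /c1 /c2; lra.
have det0 : (c1 != 0) || (c2 != 0) ->
    (r1 - p1) * (s2 - p2) - (r2 - p2) * (s1 - p1) = 0.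
  set dt := (_ - _ in LHS).
  have d1 : c1 * dt = 0.
    rewrite /dt (_ : _ * _ = (c1 * (r1 - p1) + c2 * (r2 - p2)) * (s2 - p2)
      - (r2 - p2) * (c1 * (s1 - p1) + c2 * (s2 - p2))); last by ring.
    by rewrite e2 e3 mul0r mulr0 subr0.
  have d2 : c2 * dt = 0.
    rewrite /dt (_ : _ * _ = (r1 - p1) * (c1 * (s1 - p1) + c2 * (s2 - p2))
      - (c1 * (r1 - p1) + c2 * (r2 - p2)) * (s1 - p1)); last by ring.
    by rewrite e2 e3 mul0r mulr0 subr0.
  by case/orP => c0; apply: (mulfI c0); rewrite mulr0.
have c0 : c1 = 0 /\ c2 = 0.
  have [/andP[/eqP-> /eqP->] //|] := boolP ((c1 == 0) && (c2 == 0)).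
  rewrite negb_and => /det0 {det0} det0.
  have lin' s t : s * (r1 - p1) + t * (s1 - p1) = 0 ->
      s * (r2 - p2) + t * (s2 - p2) = 0 -> s = 0 /\ t = 0.
    move=> h k; apply: lin; apply/eqP; rewrite eq_complex /=.
    by rewrite !mul0r !subr0 !addr0 h k eqxx.
  (* With zero determinant, the cofactors are coefficients of a vanishing combination. Independence
     makes them zero, so [t2 - t1 = 0], which the coefficients 1 and 0 then refute. *)
  have [||_ r20] := lin' (s2 - p2) (- (r2 - p2)); [by lra|by ring|].
  have [||_ r10] := lin' (s1 - p1) (- (r1 - p1)); [by ring|by lra|].
  have [||/eqP] := lin' 1 0; last by rewrite oner_eq0.
  - by rewrite mul0r mul1r addr0; lra.
  - by rewrite mul0r mul1r addr0; lra.
case: c0 => c10 c20.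
have W0 : w1 ^+ 2 + w2 ^+ 2 != 0.
  by rewrite paddr_eq0 ?sqr_ge0 // !sqrf_eq0.
(* Multiplying [c1 + i c2] by [w] gives back [(a - b) |w|^2]. *)
have da : a1 - b1 = 0.
  apply: (mulfI W0); rewrite mulr0 (_ : _ * _ = c1 * w1 - c2 * w2).
    by rewrite c10 c20 !mul0r subr0.
  by rewrite /c1 /c2; ring.
have db : a2 - b2 = 0.
  apply: (mulfI W0); rewrite mulr0 (_ : _ * _ = c1 * w2 + c2 * w1).
    by rewrite c10 c20 !mul0r addr0.
  by rewrite /c1 /c2; ring.
by rewrite (subr0_eq da) (subr0_eq db).
Qed.

End phase_retrieval.

(** * Far fields of two sources and uniqueness from far fields with phase *)

Section far_field.
Context {R : realType}.
Local Notation mpt := (measurableTypeR R * measurableTypeR R)%type.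

Lemma source_in_integrable (Omega : set (pt R)) (F : pt R -> R[i] * R[i]) (M : R) :
  0 <= M -> (forall y, Omega y -> `|y.1| <= M /\ `|y.2| <= M) ->
  source_in Omega F ->
  [/\ Rintegrable (@leb2 R) (fun y => complex.Re (F y).1),
      Rintegrable (@leb2 R) (fun y => complex.Re (F y).2),
      Rintegrable (@leb2 R) (fun y => complex.Im (F y).1) &
      Rintegrable (@leb2 R) (fun y => complex.Im (F y).2)].
Proof.
move=> M0 OM [[mR1 [mI1 fin1]] [[mR2 [mI2 fin2]] F0]].
have FM (g : R[i] * R[i] -> R) (y : pt R) : g (0, 0) = 0 -> g (F y) != 0 ->
    `|y.1| <= M /\ `|y.2| <= M.
  move=> g0 gy; apply: OM; apply: contrapT => /F0 Fy.
  by move: gy; rewrite Fy g0 eqxx.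
have addC_fin (f g : pt R -> R) :
    (\int[@leb2 R]_y (f y ^+ 2 + g y ^+ 2)%:E < +oo)%E ->
    (\int[@leb2 R]_y (g y ^+ 2 + f y ^+ 2)%:E < +oo)%E.
  by under eq_integral do rewrite addrC.
split.
- apply: (square_integrable_Rintegrable M _ _ M0 mR1 mI1 fin1) => y.
  exact: (FM (fun v => complex.Re v.1)).
- apply: (square_integrable_Rintegrable M _ _ M0 mR2 mI2 fin2) => y.
  exact: (FM (fun v => complex.Re v.2)).
- apply: (square_integrable_Rintegrable M _ _ M0 mI1 mR1 (addC_fin _ _ fin1)) => y.
  exact: (FM (fun v => complex.Im v.1)).
- apply: (square_integrable_Rintegrable M _ _ M0 mI2 mR2 (addC_fin _ _ fin2)) => y.
  exact: (FM (fun v => complex.Im v.2)).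
Qed.

(* [far_field t x x F] and [far_field t x (perp x) F] are the compressional and
   shear far fields of [F] at wave number [t]. *)
Definition far_field (t : R) (x e : pt R) (F : pt R -> R[i] * R[i]) : R[i] :=
  cint2 (fun y => expi (- (t * dot x y)) * rcdot e (F y)).

Lemma Re_expi_rcdot (th : R) (e : pt R) (v : R[i] * R[i]) :
  complex.Re (expi (- th) * rcdot e v) =
  cos th * (e.1 * complex.Re v.1 + e.2 * complex.Re v.2) +
  sin th * (e.1 * complex.Im v.1 + e.2 * complex.Im v.2).
Proof.
case: v => -[a1 b1] [a2 b2]; rewrite /expi /rcdot /= cosN sinN !mul0r.
by ring.
Qed.

Lemma Im_expi_rcdot (th : R) (e : pt R) (v : R[i] * R[i]) :
  complex.Im (expi (- th) * rcdot e v) =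
  cos th * (e.1 * complex.Im v.1 + e.2 * complex.Im v.2) -
  sin th * (e.1 * complex.Re v.1 + e.2 * complex.Re v.2).
Proof.
case: v => -[a1 b1] [a2 b2]; rewrite /expi /rcdot /= cosN sinN !mul0r.
by ring.
Qed.

Lemma expi_neq0 (t : R) : expi t != 0.
Proof.
rewrite eq_complex /=; apply/negP => /andP[/eqP c0 /eqP s0].
have := cos2Dsin2 t; rewrite c0 s0 expr0n /= addr0 => /esym/eqP.
by rewrite oner_eq0.
Qed.

Variables (Omega : set (pt R)) (M : R) (F G : pt R -> R[i] * R[i]).
Hypothesis M_ge0 : 0 <= M.
Hypothesis Omega_le : forall y, Omega y -> `|y.1| <= M /\ `|y.2| <= M.
Hypotheses (srcF : source_in Omega F) (srcG : source_in Omega G).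

Let u (y : mpt) := clamp M y.1.
Let v (y : mpt) := clamp M y.2.
Let A1 (y : mpt) := complex.Re (F y).1 - complex.Re (G y).1.
Let A2 (y : mpt) := complex.Re (F y).2 - complex.Re (G y).2.
Let B1 (y : mpt) := complex.Im (F y).1 - complex.Im (G y).1.
Let B2 (y : mpt) := complex.Im (F y).2 - complex.Im (G y).2.

Let bu : bounded_mfun u.
Proof. by apply: bounded_mfun_clamp => //; exact: measurable_fst. Qed.

Let bv : bounded_mfun v.
Proof. by apply: bounded_mfun_clamp => //; exact: measurable_snd. Qed.

Let A1i : Rintegrable (@leb2 R) A1.
Proof.
have [? _ _ _] := source_in_integrable _ _ _ M_ge0 Omega_le srcF.
have [? _ _ _] := source_in_integrable _ _ _ M_ge0 Omega_le srcG.
exact: RintegrableB.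
Qed.

Let A2i : Rintegrable (@leb2 R) A2.
Proof.
have [_ ? _ _] := source_in_integrable _ _ _ M_ge0 Omega_le srcF.
have [_ ? _ _] := source_in_integrable _ _ _ M_ge0 Omega_le srcG.
exact: RintegrableB.
Qed.

Let B1i : Rintegrable (@leb2 R) B1.
Proof.
have [_ _ ? _] := source_in_integrable _ _ _ M_ge0 Omega_le srcF.
have [_ _ ? _] := source_in_integrable _ _ _ M_ge0 Omega_le srcG.
exact: RintegrableB.
Qed.

Let B2i : Rintegrable (@leb2 R) B2.
Proof.
have [_ _ _ ?] := source_in_integrable _ _ _ M_ge0 Omega_le srcF.
have [_ _ _ ?] := source_in_integrable _ _ _ M_ge0 Omega_le srcG.
exact: RintegrableB.
Qed.

Let lin_int c1 c2 f g : Rintegrable (@leb2 R) f -> Rintegrable (@leb2 R) g ->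
  Rintegrable (@leb2 R) (fun y => c1 * f y + c2 * g y).
Proof. by move=> fi gi; apply: RintegrableD; exact: RintegrableZ. Qed.

Let s (x : pt R) (y : mpt) := x.1 * u y + x.2 * v y.

Let bs x : bounded_mfun (s x).
Proof. by apply: bounded_mfunD; exact: bounded_mfunZ. Qed.

(** Inside [Omega] the clamps have no effect, and outside it the source is zero; so the unbounded
    phase [dot x y] may be replaced by the bounded [s x y]. *)
Let far_field_clamp t x e H : source_in Omega H ->
  far_field t x e H =
  Complex
    (\int[@leb2 R]_y (cos (t * s x y) * (e.1 * complex.Re (H y).1 + e.2 * complex.Re (H y).2)
      + sin (t * s x y) * (e.1 * complex.Im (H y).1 + e.2 * complex.Im (H y).2)))
    (\int[@leb2 R]_y (cos (t * s x y) * (e.1 * complex.Im (H y).1 + e.2 * complex.Im (H y).2)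
      - sin (t * s x y) * (e.1 * complex.Re (H y).1 + e.2 * complex.Re (H y).2))).
Proof.
move=> [_ [_ H0]]; rewrite /far_field /cint2.
have sE (y : pt R) : Omega y -> s x y = dot x y.
  by move=> /Omega_le[y1 y2]; rewrite /s /u /v !clamp_id.
congr Complex; apply: eq_Rintegral => y _.
  rewrite Re_expi_rcdot; have [/sE -> //|/H0 ->] := pselect (Omega y).
  by rewrite /= !mulr0 !addr0 !mulr0.
rewrite Im_expi_rcdot; have [/sE -> //|/H0 ->] := pselect (Omega y).
by rewrite /= !mulr0 !addr0 !mulr0.
Qed.

Let far_field_eq_integrals t x e : far_field t x e F = far_field t x e G ->
  \int[@leb2 R]_y (cos (t * s x y) * (e.1 * A1 y + e.2 * A2 y)
    + sin (t * s x y) * (e.1 * B1 y + e.2 * B2 y)) = 0 /\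
  \int[@leb2 R]_y (cos (t * s x y) * (e.1 * B1 y + e.2 * B2 y)
    - sin (t * s x y) * (e.1 * A1 y + e.2 * A2 y)) = 0.
Proof.
have mts : measurable_fun setT (fun y => t * s x y).
  by apply: measurable_funM => //; case: (bs x).
have bc := bounded_mfun_cos _ mts.
have bsn := bounded_mfun_sin _ mts.
have [F1 F2 F3 F4] := source_in_integrable _ _ _ M_ge0 Omega_le srcF.
have [G1 G2 G3 G4] := source_in_integrable _ _ _ M_ge0 Omega_le srcG.
rewrite !far_field_clamp // => -[eR eI].
split.
- move/eqP: eR; rewrite -subr_eq0 -RintegralB //.
  + by move/eqP => <-; apply: eq_Rintegral => y _; rewrite /A1 /A2 /B1 /B2; ring.
  + by apply: RintegrableD; apply: RintegrableM => //; exact: lin_int.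
  + by apply: RintegrableD; apply: RintegrableM => //; exact: lin_int.
- move/eqP: eI; rewrite -subr_eq0 -RintegralB //.
  + by move/eqP => <-; apply: eq_Rintegral => y _; rewrite /A1 /A2 /B1 /B2; ring.
  + by apply: RintegrableB; apply: RintegrableM => //; exact: lin_int.
  + by apply: RintegrableB; apply: RintegrableM => //; exact: lin_int.
Qed.

(** The polarization [e] is kept free of [x] to cover both [e = x] and [e = perp x]. *)
Let far_field_eq_moments (t1 t2 : R) x e : t1 < t2 ->
  (forall t, t1 < t < t2 -> far_field t x e F = far_field t x e G) ->
  forall n, \int[@leb2 R]_y (s x y ^+ n * (e.1 * A1 y + e.2 * A2 y)) = 0 /\
    \int[@leb2 R]_y (s x y ^+ n * (e.1 * B1 y + e.2 * B2 y)) = 0.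
Proof.
move=> t12 E; apply: (trig_integral_moments _ _ _ _ t1 t2) => //.
- exact: lin_int.
- exact: lin_int.
- by move=> t /E /far_field_eq_integrals[].
- by move=> t /E /far_field_eq_integrals[].
Qed.

(** The two intervals of wave numbers are unrelated: each leads separately to moment identities,
    where the wave number no longer occurs, and only these are combined. *)
Lemma far_field_uniqueness (q : pt R) (p1 p2 s1 s2 : R) : unit_circle q ->
  p1 < p2 -> s1 < s2 ->
  (forall x t, Sq q x -> p1 < t < p2 -> far_field t x x F = far_field t x x G) ->
  (forall x t, Sq_perp q x -> s1 < t < s2 ->
    far_field t x (perp x) F = far_field t x (perp x) G) ->
  {ae @leb2 R, forall y, F y = G y}.
Proof.
move=> q1 p12 s12 Hp Hs.
have mA n := vector_moments (@leb2 R) u v A1 A2 n q bu bv A1i A2i q1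
  (fun x hx => (far_field_eq_moments _ _ x x p12 (fun t => Hp x t hx) n).1)
  (fun x hx => (far_field_eq_moments _ _ x (perp x) s12 (fun t => Hs x t hx) n).1).
have mB n := vector_moments (@leb2 R) u v B1 B2 n q bu bv B1i B2i q1
  (fun x hx => (far_field_eq_moments _ _ x x p12 (fun t => Hp x t hx) n).2)
  (fun x hx => (far_field_eq_moments _ _ x (perp x) s12 (fun t => Hs x t hx) n).2).
have supp (g : R[i] * R[i] -> R) (y : pt R) : g (F y) - g (G y) != 0 ->
    `|y.1| <= M /\ `|y.2| <= M.
  move=> gy; apply: Omega_le; apply: contrapT => Oy.
  have [_ [_ F0]] := srcF; have [_ [_ G0]] := srcG.
  by move: gy; rewrite F0 // G0 // subrr eqxx.
have A10 : {ae @leb2 R, forall y, A1 y = 0}.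
  apply: (moments0_ae_eq0 M) => // [y|j k]; first exact: (supp (fun w => complex.Re w.1)).
  (* The moment with exponents [j] and [k] is entry [k] in degree [j + k]. *)
  by have [] := mA (j + k)%N k (leq_addl _ _); rewrite addnK.
have A20 : {ae @leb2 R, forall y, A2 y = 0}.
  apply: (moments0_ae_eq0 M) => // [y|j k]; first exact: (supp (fun w => complex.Re w.2)).
  by have [] := mA (j + k)%N k (leq_addl _ _); rewrite addnK.
have B10 : {ae @leb2 R, forall y, B1 y = 0}.
  apply: (moments0_ae_eq0 M) => // [y|j k]; first exact: (supp (fun w => complex.Im w.1)).
  by have [] := mB (j + k)%N k (leq_addl _ _); rewrite addnK.
have B20 : {ae @leb2 R, forall y, B2 y = 0}.
  apply: (moments0_ae_eq0 M) => // [y|j k]; first exact: (supp (fun w => complex.Im w.2)).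
  by have [] := mB (j + k)%N k (leq_addl _ _); rewrite addnK.
apply: filterS (filterI (filterI A10 A20) (filterI B10 B20)) => y [[]].
rewrite /A1 /A2 /B1 /B2 => /subr0_eq eA1 /subr0_eq eA2 [/subr0_eq eB1 /subr0_eq eB2].
rewrite [F y]surjective_pairing [G y]surjective_pairing.
by congr pair; apply/eqP; rewrite eq_complex ?eA1 ?eA2 ?eB1 ?eB2 !eqxx.
Qed.

End far_field.

(** * Passage from phaseless data to far fields *)

Theorem theorem3p4 (R : realType) (omega_min omega_max lam mu : R)
    (Omega : set (pt R)) (tau1 tau2 tau3 : R[i]) (z q : pt R)
    (F G : pt R -> R[i] * R[i]) :
  0 < omega_min -> omega_min < omega_max ->
  0 < mu -> 0 < 2 * mu + lam ->
  bounded_domain Omega ->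
  tau1 != tau2 -> tau1 != tau3 -> tau2 != tau3 ->
  lin_indep_R (tau2 - tau1) (tau3 - tau1) ->
  ~ closure Omega z ->
  unit_circle q ->
  source_in Omega F -> source_in Omega G ->
  (forall xh omega tau, Sq q xh -> omega_min < omega < omega_max ->
     tau \in [:: tau1; tau2; tau3] ->
     `| uinf_pz lam mu F z q xh omega tau | = `| uinf_pz lam mu G z q xh omega tau |) ->
  (forall xh omega tau, Sq_perp q xh -> omega_min < omega < omega_max ->
     tau \in [:: tau1; tau2; tau3] ->
     `| uinf_sz mu F z q xh omega tau | = `| uinf_sz mu G z q xh omega tau |) ->
  {ae @leb2 R, forall y, F y = G y}.
Proof.
move=> wmin0 wmm mu0 lm0 [[y0 Oy0] [_ [_ [M OM]]]] _ _ _ lin _ q1 srcF srcG Dp Ds.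
(* Nonemptiness of [Omega] makes the bound nonnegative. *)
have M0 : 0 <= M by have [h _] := OM _ Oy0; exact: le_trans h.
have retrieve x e t : 1 / 2 <= dot q e ->
    (forall tau, tau \in [:: tau1; tau2; tau3] ->
      `|far_field t x e F + tau * expi (- (t * dot x z)) * (dot q e)%:C%C| =
      `|far_field t x e G + tau * expi (- (t * dot x z)) * (dot q e)%:C%C|) ->
    far_field t x e F = far_field t x e G.
  move=> qe H.
  apply: (phase_retrieval _ _ (expi (- (t * dot x z)) * (dot q e)%:C%C)
    tau1 tau2 tau3) => //.
    rewrite mulf_neq0 ?expi_neq0 // eq_complex /= eqxx andbT gt_eqF //.
    by apply: lt_le_trans qe; rewrite divr_gt0.
  by move=> tau /H; rewrite -!mulrA.
have cp : 0 < Num.sqrt (lam + 2 * mu) by rewrite sqrtr_gt0 addrC.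
have cs : 0 < Num.sqrt mu by rewrite sqrtr_gt0.
(* Dividing the frequency band by a wave speed [c] gives the interval of wave numbers on which the
   far fields agree. *)
have ltk c : 0 < c -> omega_min / c < omega_max / c.
  by move=> c0; rewrite ltr_pM2r // invr_gt0.
have inW c t : 0 < c -> omega_min / c < t < omega_max / c ->
    omega_min < t * c < omega_max.
  by move=> c0; rewrite ltr_pdivrMr // ltr_pdivlMr.
apply: (far_field_uniqueness Omega M F G M0 OM srcF srcG q
  _ _ _ _ q1 (ltk _ cp) (ltk _ cs)).
- move=> x t xq /(inW _ _ cp) tw; have [_ qx] := xq.
  apply: (retrieve x x t qx) => tau htau.
  have := Dp x _ tau xq tw htau.
  by rewrite /uinf_pz /uinf_p /kp mulfK ?gt_eqF.
- move=> x t xq /(inW _ _ cs) tw; have [_ qx] := xq.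
  apply: (retrieve x (perp x) t qx) => tau htau.
  have := Ds x _ tau xq tw htau.
  by rewrite /uinf_sz /uinf_s /ks mulfK ?gt_eqF.
Qed.
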